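(* Let $\mathbb{F}$ be a field of characteristic not $2$, let $\mathcal{U}$ be a nonzero finite-dimensional $\mathbb{F}$-vector space with $\dim_{\mathbb{F}}\mathcal{U}=n$, let $b:\mathcal{U}\times\mathcal{U}\to\mathbb{F}$ be a nondegenerate symmetric bilinear form, and let $g:\mathcal{U}\to\mathcal{U}$ be a diagonalizable endomorphism that is symmetric relative to $b$ (i.e. $b(g(u),v)=b(u,g(v))$ for all $u,v$). Let $\mathcal{E}(\mathcal{U},b,g)=\mathcal{U}\times\mathbb{F}\times\mathbb{F}$ be the algebra with multiplication $$(u,\alpha,\beta)(v,\gamma,\delta)=(0,\,b(u,v),\,b(g(u),v)+\alpha\gamma)$$ for $u,v\in\mathcal{U}$, $\alpha,\beta,\gamma,\delta\in\mathbb{F}$. Then $\mathcal{E}(\mathcal{U},b,g)$ is a nilpotent evolution algebra of type $[1,1,n]$.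
   Context: An evolution algebra (finite-dimensional here) is an algebra $\mathcal{E}$ over $\mathbb{F}$ with a basis $\{e_1,\ldots,e_m\}$ (a natural basis) such that $e_je_k=0$ for $j\neq k$. For an algebra $\mathcal{A}$, $\mathrm{ann}(\mathcal{A})=\{x\in\mathcal{A}: x\mathcal{A}=\mathcal{A}x=0\}$, $\mathrm{ann}^0(\mathcal{A})=0$, and $\mathrm{ann}^i(\mathcal{A})$ is defined by $\mathrm{ann}^i(\mathcal{A})/\mathrm{ann}^{i-1}(\mathcal{A})=\mathrm{ann}(\mathcal{A}/\mathrm{ann}^{i-1}(\mathcal{A}))$. With $\mathcal{A}^1=\mathcal{A}$ and $\mathcal{A}^{k+1}=\sum_{j=1}^k\mathcal{A}^j\mathcal{A}^{k+1-j}$, $\mathcal{A}$ is nilpotent if $\mathcal{A}^m=0$ for some $m$, equivalently $\mathrm{ann}^r(\mathcal{A})=\mathcal{A}$ for some $r$. The type of a finite-dimensional nilpotent algebra $\mathcal{A}$ is the sequence $[n_1,\ldots,n_r]$, where $r$ is the least natural number with $\mathrm{ann}^r(\mathcal{A})=\mathcal{A}$ and $n_i=\dim\mathrm{ann}^i(\mathcal{A})-\dim\mathrm{ann}^{i-1}(\mathcal{A})$. *)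

(* Defs.v *)
From HB Require Import structures.
From mathcomp Require Import all_boot all_algebra.

Set Implicit Arguments.
Unset Strict Implicit.
Unset Printing Implicit Defensive.

Import GRing.Theory.
Local Open Scope ring_scope.

(* A finite-dimensional, not necessarily associative or unital, F-algebra is a
   space A : vectType F together with mul : {bilinear A -> A -> A}. *)

Section Annihilator.
Variables (F : fieldType) (A : vectType F) (mul : {bilinear A -> A -> A}).

Definition lmul (x : A) : 'End(A) := linfun (mul x).
Definition rmul (x : A) : 'End(A) := linfun (applyr mul x).

Lemma lmul_linear : linear lmul.
Proof.
move=> a x y; apply/lfunP=> z.
by rewrite add_lfunE scale_lfunE !lfunE /= linearPl.
Qed.

Lemma rmul_linear : linear rmul.
Proof.
move=> a x y; apply/lfunP=> z.
by rewrite add_lfunE scale_lfunE !lfunE /= linearPr.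
Qed.

HB.instance Definition _ := GRing.isLinear.Build _ _ _ _ lmul lmul_linear.
HB.instance Definition _ := GRing.isLinear.Build _ _ _ _ rmul rmul_linear.

Definition ann : {vspace A} := (lker (linfun lmul) :&: lker (linfun rmul))%VS.

Lemma mem_annP x :
  reflect (forall y, mul x y = 0 /\ mul y x = 0) (x \in ann).
Proof.
rewrite memv_cap !memv_ker !lfunE /=; apply: (iffP andP) => [[/eqP l /eqP r] y|h].
  split; first by move/lfunP/(_ y): l; rewrite !lfunE.
  by move/lfunP/(_ y): r; rewrite !lfunE.
by split; apply/eqP/lfunP=> y; rewrite !lfunE /=; case: (h y).
Qed.

End Annihilator.

(* The quotient A / I is realized on the complement I^C, the projection of A
   onto I^C along I playing the role of the canonical surjection.  It is the
   quotient algebra as soon as I is a two-sided ideal: see quot_projM. *)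
Section Quotient.
Variables (F : fieldType) (A : vectType F) (mul : {bilinear A -> A -> A}).
Variable I : {vspace A}.

Definition quot : vectType F := subvs_of (I^C)%VS.

Definition quot_proj (x : A) : quot := Subvs (memv_projC I x).

Lemma quot_proj_linear : linear quot_proj.
Proof.
move=> a x y; apply/val_inj; rewrite /= linearP /= scalerBr opprD !addrA.
by congr (_ + _); rewrite -!addrA; congr (_ + _); rewrite addrC.
Qed.

HB.instance Definition _ :=
  GRing.isLinear.Build _ _ _ _ quot_proj quot_proj_linear.

Lemma quot_proj_eq0 x : (quot_proj x == 0) = (x \in I).
Proof.
rewrite -val_eqE /= subr_eq0; apply/eqP/idP => [->|xI]; first exact: memv_proj.
by rewrite projv_id.
Qed.

Lemma quot_projK : cancel (vsval : quot -> A) quot_proj.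
Proof.
move=> x; apply/val_inj; rewrite /=.
suff /eqP -> : projv I (vsval x) == 0 by rewrite subr0.
by rewrite -memv_ker lker_proj subvsP.
Qed.

Definition quot_mul (x y : quot) : quot := quot_proj (mul (vsval x) (vsval y)).

Lemma quot_mul_bilinear : bilinear_for
  (GRing.Scale.Law.clone _ _ *:%R _) (GRing.Scale.Law.clone _ _ *:%R _)
  quot_mul.
Proof.
split=> [z|z] a x y; rewrite /quot_mul linearP /=.
  by rewrite linearPl linearP.
by rewrite linearP.
Qed.

HB.instance Definition _ :=
  bilinear_isBilinear.Build F quot quot quot _ _ quot_mul quot_mul_bilinear.

Lemma quot_projM :
    (forall x y, x \in I -> mul x y \in I /\ mul y x \in I) ->
  forall x y, quot_proj (mul x y) = quot_mul (quot_proj x) (quot_proj y).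
Proof.
move=> idI x y; apply/eqP; rewrite -subr_eq0 -linearB quot_proj_eq0 /=.
set p := projv I x; set q := projv I y.
have pI : p \in I by exact: memv_proj.
have qI : q \in I by exact: memv_proj.
have -> : mul x y - mul (x - p) (y - q) = mul p y + mul (x - p) q.
  by rewrite linearBr /= opprB addrCA -linearBl /= subKr addrC.
by apply: memvD; [case: (idI p y pI) | case: (idI q (x - p) qI)].
Qed.

End Quotient.

Arguments quot_proj {F A} I x.
Arguments quot_mul {F A} mul I x y.

Section Nilpotency.
Variables (F : fieldType) (A : vectType F) (mul : {bilinear A -> A -> A}).

Fixpoint ann_iter (i : nat) : {vspace A} :=
  if i is j.+1 then
    (linfun (quot_proj (ann_iter j)) @^-1: ann (quot_mul mul (ann_iter j)))%VS
  else 0%VS.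

Let ideal (I : {vspace A}) :=
  forall x y, x \in I -> mul x y \in I /\ mul y x \in I.

Let mem_ann_iterS i x : ideal (ann_iter i) ->
  reflect (forall y, mul x y \in ann_iter i /\ mul y x \in ann_iter i)
          (x \in ann_iter i.+1).
Proof.
move=> idI; rewrite /= -memv_preim lfunE /=.
apply: (iffP (mem_annP _ _)) => [h y|h z].
  have [/eqP l /eqP r] := h (quot_proj (ann_iter i) y).
  by move: l r; rewrite /= -!quot_projM // !quot_proj_eq0.
have [l r] := h (vsval z).
by rewrite -(quot_projK z) /= -!quot_projM //; split; apply/eqP;
   rewrite quot_proj_eq0.
Qed.

Lemma ann_iter_ideal i x y : x \in ann_iter i ->
  mul x y \in ann_iter i /\ mul y x \in ann_iter i.
Proof.
elim: i x y => [|i IHi] x y.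
  by rewrite !memv0 => /eqP ->; rewrite linear0l linear0r.
move=> /(mem_ann_iterS _ IHi)/(_ y)[l r].
by split; apply/(mem_ann_iterS _ IHi) => z; apply: IHi.
Qed.

Lemma mem_ann_iterP i x :
  reflect (forall y, mul x y \in ann_iter i /\ mul y x \in ann_iter i)
          (x \in ann_iter i.+1).
Proof. exact/mem_ann_iterS/ann_iter_ideal. Qed.

(* The subspace spanned by the products of elements of U and V. *)
Definition prod_space (U V : {vspace A}) : {vspace A} :=
  <<[seq mul u v | u <- vbasis U, v <- vbasis V]>>%VS.

Lemma prod_spaceP (U V W : {vspace A}) :
  reflect {in U & V, forall u v, mul u v \in W} (prod_space U V <= W)%VS.
Proof.
apply: (iffP span_subvP) => h.
  move=> u v /coord_vbasis -> /coord_vbasis ->.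
  rewrite linear_sumlz rpred_sum // => i _.
  rewrite linear_sumr rpred_sum // => j _.
  rewrite linearZr linearZl_LR !rpredZ //; apply: h.
  by apply: allpairs_f; rewrite mem_nth // size_tuple.
by move=> _ /allpairsP[[u v] /= [/vbasis_mem uU /vbasis_mem vV ->]]; apply: h.
Qed.

(* alg_pows k is the sequence [:: A^1; ...; A^k]. *)
Fixpoint alg_pows (k : nat) : seq {vspace A} :=
  if k is k'.+1 then
    let s := alg_pows k' in
    rcons s (if k' is 0 then fullv else
      \sum_(1 <= j < k'.+1)
        prod_space (nth fullv s j.-1) (nth fullv s (k' - j)))%VS
  else [::].

(* A^k for 0 < k; see alg_pow1 and alg_powS. *)
Definition alg_pow (k : nat) : {vspace A} := nth fullv (alg_pows k) k.-1.

Lemma size_alg_pows k : size (alg_pows k) = k.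
Proof. by elim: k => //= k IHk; rewrite size_rcons IHk. Qed.

Lemma nth_alg_pows k j : (j < k)%N -> nth fullv (alg_pows k) j = alg_pow j.+1.
Proof.
elim: k => // k IHk; rewrite ltnS leq_eqVlt => /predU1P[->//|jk].
by rewrite [alg_pows _]/= nth_rcons size_alg_pows jk IHk.
Qed.

Lemma alg_pow1 : alg_pow 1 = fullv.
Proof. by []. Qed.

Lemma alg_powS k : (0 < k)%N ->
  alg_pow k.+1 =
    (\sum_(1 <= j < k.+1) prod_space (alg_pow j) (alg_pow (k.+1 - j)))%VS.
Proof.
move=> k0; rewrite /alg_pow /= nth_rcons size_alg_pows ltnn eqxx.
case: k k0 => // k _; rewrite big_nat [RHS]big_nat.
apply: eq_bigr => j /andP[j1 jk]; rewrite -!/(alg_pow _).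
rewrite !nth_alg_pows ?prednK //; last by rewrite ltn_subrL j1.
by rewrite [in RHS]subSn.
Qed.

Definition nilpotent_alg : Prop :=
  exists m : nat, (0 < m)%N /\ alg_pow m = 0%VS.

(* The natural-number subtraction is exact, ann_iter being nondecreasing. *)
Definition has_type (s : seq nat) : Prop :=
  [/\ ann_iter (size s) = fullv,
      forall r, ann_iter r = fullv -> (size s <= r)%N &
      forall i, (i < size s)%N ->
        nth 0%N s i = (\dim (ann_iter i.+1) - \dim (ann_iter i))%N].

Definition evolution_alg : Prop :=
  exists (m : nat) (e : m.-tuple A), basis_of fullv e /\
    forall j k : 'I_m, j != k -> mul (tnth e j) (tnth e k) = 0.

End Nilpotency.

Definition diagonalizable_end (F : fieldType) (U : vectType F) (g : 'End(U)) :
    Prop :=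
  exists e : seq U, basis_of fullv e /\
    forall x, x \in e -> exists a : F, g x = a *: x.

Section EvolutionAlgebraOfForm.
Variables (F : fieldType) (U : vectType F) (b : {symmetric U}) (g : 'End(U)).

Definition Ebg : vectType F := (U * F^o * F^o)%type.

Definition Ebg_mul (x y : Ebg) : Ebg :=
  let: (u, alpha, beta) := x in
  let: (v, gamma, delta) := y in
  (0, b u v, b (g u) v + alpha * gamma).

Lemma Ebg_mul_bilinear : bilinear_for
  (GRing.Scale.Law.clone _ _ *:%R _) (GRing.Scale.Law.clone _ _ *:%R _)
  Ebg_mul.
Proof.
have scE (k l : F) : k *: (l : F^o) = k * l by [].
split=> [[[w c] d]|[[w c] d]] a [[u c1] d1] [[v c2] d2] /=.
  congr (_, _, _) => /=.
  - by rewrite scaler0 addr0.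
  - by rewrite linearPl.
  by rewrite linearP linearPl /= !scE mulrDl mulrDr !mulrA addrACA.
congr (_, _, _) => /=.
- by rewrite scaler0 addr0.
- by rewrite linearPr.
by rewrite linearPr /= !scE !mulrDr (mulrCA c) addrACA.
Qed.

HB.instance Definition _ :=
  bilinear_isBilinear.Build F Ebg Ebg Ebg _ _ Ebg_mul Ebg_mul_bilinear.

End EvolutionAlgebraOfForm.

(* Main.v *)
Require Import Defs.
From HB Require Import structures.
From mathcomp Require Import all_boot all_algebra.
Local Open Scope ring_scope.
Import GRing.Theory.

(* As g is b-symmetric, distinct eigenspaces of g are b-orthogonal, so in
   characteristic not 2 Gram-Schmidt turns an eigenbasis of g into one that is
   also b-orthogonal. Then b u v = b (g u) v = 0 for distinct members u, v of
   this basis, and adjoining (0, 1, 0) and (0, 0, 1) gives a natural basis.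
   Since b is nondegenerate, ann^1 = 0 x 0 x F, ann^2 = 0 x F x F and ann^3 is
   the whole algebra. *)

(** * Orthogonal eigenbases by Gram-Schmidt *)

Section OrthogonalEigenbasis.
Variables (F : fieldType) (U : vectType F) (b : {symmetric U}).

Lemma symmetric_formC u v : b u v = b v u.
Proof. by rewrite hermC expr0 mul1r. Qed.

Lemma eq_span_sub (X Y : seq U) : {subset X <= <<Y>>%VS} ->
  {subset Y <= <<X>>%VS} -> <<X>>%VS = <<Y>>%VS.
Proof.
by move=> *; apply/eqP; rewrite eqEsubv; apply/andP; split; apply/span_subvP.
Qed.

(** Lets Gram-Schmidt subtract multiples of the pivot [w] from the other vectors without losing the
    span. *)
Lemma span_consB (w : U) (t : seq U) (c : U -> F) :
  <<w :: [seq x - c x *: w | x <- t]>>%VS = <<w :: t>>%VS.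
Proof.
have wZ s a : a *: w \in <<w :: s>>%VS by rewrite rpredZ ?memv_span ?mem_head.
have tS s y : y \in s -> y \in <<w :: s>>%VS.
  by move=> ys; rewrite memv_span // inE ys orbT.
apply: eq_span_sub => y; rewrite inE => /predU1P[->|].
- by rewrite memv_span ?mem_head.
- by case/mapP=> x xt ->; apply: rpredB; [apply: tS | apply: wZ].
- by rewrite memv_span ?mem_head.
move=> yt; rewrite -(subrK (c y *: w) y); apply: rpredD; last exact: wZ.
exact/tS/(map_f (fun x => x - c x *: w)).
Qed.

Lemma span_addl (x y : U) (t : seq U) :
  y \in t -> <<(x + y)%R :: t>>%VS = <<x :: t>>%VS.
Proof.
move=> yt; have tS z u : u \in t -> u \in <<z :: t>>%VS.
  by move=> ut; rewrite memv_span // inE ut orbT.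
have headS z : z \in <<z :: t>>%VS by rewrite memv_span ?mem_head.
apply: eq_span_sub => z; rewrite inE => /predU1P[->|]; try exact: tS.
  by apply: rpredD; [apply: headS | apply: tS].
rewrite -[x in X in X \in _](addrK y).
by apply: rpredB; [apply: headS | apply: tS].
Qed.

Variable g : 'End(U).
Hypothesis gS : forall u v, b (g u) v = b u (g v).

Definition eigenvector (x : U) := exists a : F, g x = a *: x.

(** Symmetry of [g] gives [a * b x y = c * b x y], and the nonzero factor [b x y] cancels. *)
Lemma eigenvector_ortho {x y a c} :
  g x = a *: x -> g y = c *: y -> b x y != 0 -> a = c.
Proof.
move=> gx gy bxy; apply: (mulIf bxy); have := gS x y.
by rewrite gx gy linearZl_LR linearZr.
Qed.

(** Non-orthogonal eigenvectors lie in one eigenspace, which is closed under linear combinations.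
    This keeps Gram-Schmidt among eigenvectors. *)
Lemma eigenvectorD x y : eigenvector x -> eigenvector y -> b x y != 0 ->
  forall c, eigenvector (x + c *: y).
Proof.
move=> [a gx] [a' gy] bxy c; exists a.
rewrite linearD linearZ /= gx gy (eigenvector_ortho gx gy bxy).
by rewrite scalerDr !scalerA mulrC.
Qed.

Hypothesis char2 : 2%N \notin [pchar F].

(* An orthogonal set of eigenvectors is found by Gram-Schmidt, pivoting on a
   non-isotropic member w; w is x + y if every member is isotropic but
   x and y are not orthogonal, as then b (x + y) (x + y) = 2 b x y. *)
Lemma orthogonal_eigenvectors (s : seq U) :
    {in s, forall x, eigenvector x} ->
  exists t : seq U, [/\ size t = size s, <<t>>%VS = <<s>>%VS,
    {in t, forall x, eigenvector x} & pairwise (fun x y => b x y == 0) t].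
Proof.
have [k] := ubnP (size s); elim: k s => // k IHk s sk eig_s.
have pivot w t : (size t < k)%N -> b w w != 0 ->
    {in w :: t, forall x, eigenvector x} ->
    exists r, [/\ size r = (size t).+1, <<r>>%VS = <<w :: t>>%VS,
      {in r, forall x, eigenvector x} & pairwise (fun x y => b x y == 0) r].
  move=> tk bww eig_wt; pose c x := b x w / b w w.
  have [|x|r [sz_r span_r eig_r ort_r]] := IHk [seq x - c x *: w | x <- t].
  - by rewrite size_map.
  - case/mapP=> {}x xt ->; rewrite -scaleNr /c.
    (* If [b x w = 0], the correction vanishes and [x] is unchanged; otherwise [x] and [w] share an
       eigenvalue. *)
    have [->|bxw] := eqVneq (b x w) 0.
      by rewrite mul0r oppr0 scale0r addr0; apply: eig_wt; rewrite inE xt orbT.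
    by apply: eigenvectorD => //; apply: eig_wt; rewrite inE ?eqxx // xt orbT.
  exists (w :: r); split.
  - by rewrite /= sz_r size_map.
  - by rewrite span_cons span_r -span_cons span_consB.
  - move=> x; rewrite inE => /predU1P[->|/eig_r//].
    by apply: eig_wt; rewrite mem_head.
  (* The induction hypothesis controls [r] only through its span, so orthogonality to [w] is checked
     on the spanning vectors [x - c x *: w], where it holds by the choice of [c]. *)
  rewrite pairwise_cons ort_r andbT; apply/allP=> y /memv_span.
  rewrite span_r symmetric_formC -mem_orthov1.
  apply/subvP/span_subvP => _ /mapP[x _ ->].
  by rewrite mem_orthov1 linearBl linearZl_LR /= divfK // subrr.
have [/hasP[w ws bww]|/hasPn iso] := boolP (has (fun x => b x x != 0) s).
  have ps := perm_to_rem ws.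
  have sz : size s = (size (rem w s)).+1 by rewrite (perm_size ps).
  rewrite sz (eq_span (perm_mem ps)); apply: pivot => //.
    by rewrite -ltnS -sz.
  by move=> x; rewrite -(perm_mem ps); apply: eig_s.
have [/hasP[x xs /hasP[y ys bxy]]|ort] :=
    boolP (has (fun x => has (fun y => b x y != 0) s) s); last first.
  exists s; split=> //; apply/(pairwiseP 0) => i j i_s j_s _.
  move/hasPn/(_ _ (mem_nth 0 i_s))/hasPn/(_ _ (mem_nth 0 j_s)): ort.
  by rewrite negbK.
have ps := perm_to_rem xs; pose t := rem x s.
(* [y] differs from [x], since [x] is isotropic while [b x y != 0]. *)
have yt : y \in t.
  move: ys; rewrite (perm_mem ps) inE => /predU1P[yx|//].
  by move: bxy (iso _ xs); rewrite yx => ->.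
have sz : size s = (size t).+1 by rewrite (perm_size ps).
have isoP z : z \in s -> b z z = 0.
  by move=> zs; apply/eqP; rewrite -[_ == _]negbK iso.
rewrite (eq_span (perm_mem ps)) -(span_addl x y t yt) sz; apply: pivot => //.
- by rewrite -ltnS -sz.
- rewrite linearDl !linearDr /= !isoP // add0r addr0 (symmetric_formC y).
  by rewrite -mulr2n -mulr_natl mulf_neq0.
move=> z; rewrite inE => /predU1P[->|zt].
  by rewrite -[y]scale1r; apply: eigenvectorD => //; apply: eig_s.
by apply: eig_s; rewrite (perm_mem ps) inE zt orbT.
Qed.

Lemma orthogonal_eigenbasis : diagonalizable_end g ->
  exists t : seq U, [/\ basis_of fullv t,
    {in t, forall x, eigenvector x} & pairwise (fun x y => b x y == 0) t].
Proof.
move=> [s [bas_s eig_s]].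
have [t [sz_t span_t eig_t ort_t]] := orthogonal_eigenvectors s eig_s.
(* [t] spans the space and has as many members as the basis [s], hence is itself a basis. *)
exists t; split=> //; rewrite basisEdim span_t (span_basis bas_s) subvv sz_t.
by rewrite -(eqnP (basis_free bas_s)) (span_basis bas_s) leqnn.
Qed.

End OrthogonalEigenbasis.

(** Each multiplication by arbitrary elements descends one step of the annihilator series; this
    drives the nilpotency bound. *)
Lemma prod_space_annS (F : fieldType) (A : vectType F)
    (mul : {bilinear A -> A -> A}) (i : nat) (V W : {vspace A}) :
  (V <= ann_iter mul i.+1)%VS ->
  (prod_space mul V W <= ann_iter mul i)%VS /\
  (prod_space mul W V <= ann_iter mul i)%VS.
Proof.
move=> /subvP sV; split; apply/prod_spaceP=> x y.
  by move=> /sV/mem_ann_iterP/(_ y)[].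
by move=> _ /sV/mem_ann_iterP/(_ x)[].
Qed.

Arguments prod_space_annS {F A} mul i V W _.

(** * The natural basis of the algebra *)

Section AlgebraOfForm.
Variables (F : fieldType) (U : vectType F) (b : {symmetric U}) (g : 'End(U)).
Local Notation mul := (Ebg_mul b g).

Definition Ebg_inU (u : U) : Ebg U := (u, 0, 0).
Definition Ebg_e1 : Ebg U := (0, 1, 0).
Definition Ebg_e2 : Ebg U := (0, 0, 1).

Lemma Ebg_eq (x y : Ebg U) :
  x.1.1 = y.1.1 -> x.1.2 = y.1.2 -> x.2 = y.2 -> x = y.
Proof. by case: x y => [[? ?] ?] [[? ?] ?] /= -> -> ->. Qed.

Lemma Ebg_inU_linear : linear Ebg_inU.
Proof. by move=> a u v; apply: Ebg_eq; rewrite //= scaler0 addr0. Qed.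

HB.instance Definition _ :=
  GRing.isLinear.Build F U (Ebg U) _ Ebg_inU Ebg_inU_linear.

Lemma EbgE (x : Ebg U) :
  x = Ebg_inU x.1.1 + (x.1.2 *: Ebg_e1 + x.2 *: Ebg_e2).
Proof.
apply: Ebg_eq => /=.
- by rewrite !scaler0 !addr0.
- by rewrite scaler0 addr0 add0r [_ *: _]mulr1.
- by rewrite scaler0 !add0r [_ *: _]mulr1.
Qed.

Lemma dim_Ebg : \dim {: Ebg U} = (\dim {:U}).+2.
Proof. by rewrite !dimvf -addn2 -[2%N]/(1 + 1)%N addnA. Qed.

Lemma Ebg_basis (t : seq U) : basis_of fullv t ->
  basis_of {: Ebg U} (Ebg_e1 :: Ebg_e2 :: [seq Ebg_inU u | u <- t]).
Proof.
move=> bas_t; rewrite basisEdim dim_Ebg /= size_map.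
rewrite -(span_basis bas_t) (eqnP (basis_free bas_t)) leqnn andbT.
apply/subvP=> x _; rewrite (EbgE x) !span_cons addvA addrC.
rewrite !memv_add ?memvZ ?memv_line //.
rewrite (coord_basis (X := in_tuple t) bas_t (memvf x.1.1)).
rewrite linear_sum rpred_sum // => i _.
by rewrite linearZ memvZ // memv_span // map_f // mem_nth.
Qed.

Lemma Ebg_mulC x y : (forall u v, b (g u) v = b u (g v)) ->
  mul x y = mul y x.
Proof.
case: x y => [[u a] c] [[v a'] c'] gS /=.
by rewrite gS mulrC ![b _ v]symmetric_formC [b u _]symmetric_formC.
Qed.

Lemma Ebg_evolution : 2%N \notin [pchar F] ->
  (forall u v, b (g u) v = b u (g v)) -> diagonalizable_end g ->
  evolution_alg mul.
Proof.
move=> char2 gS diag_g.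
have [t [bas_t eig_t ort_t]] := orthogonal_eigenbasis _ _ b g gS char2 diag_g.
have := Ebg_basis t bas_t; set e := _ :: _ => bas_e.
have ort_e : pairwise (fun x y => mul x y == 0) e.
  have m00 (x y : F) : x = 0 -> y = 0 -> ((0, x, y) : Ebg U) == 0.
    by move=> -> ->.
  rewrite /e !pairwise_cons pairwise_map /=; apply/and3P; split.
  - apply/andP; split; [|apply/allP=> _ /mapP[u _ ->]]; apply: m00;
      rewrite ?linear0 ?linear0l ?mulr0 ?addr0 //.
  - apply/allP=> _ /mapP[u _ ->]; apply: m00;
      by rewrite ?linear0 ?linear0l ?mul0r ?addr0.
  apply: (sub_in_pairwise (P := mem t)) ort_t; last exact/allP.
  move=> u v /eig_t[a gu] _ /eqP buv; apply: m00 => //.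
  by rewrite gu linearZl_LR /= buv !mulr0 addr0.
exists (size e), (in_tuple e); split=> // j k.
rewrite !(tnth_nth 0) /= neq_ltn => /orP[] jk.
  by apply/eqP; move/(pairwiseP 0): ort_e; apply; rewrite ?inE ?ltn_ord.
(* [pairwise] only covers an earlier member times a later one; commutativity gives the other
   order. *)
rewrite Ebg_mulC //; apply/eqP.
by move/(pairwiseP 0): ort_e; apply; rewrite ?inE ?ltn_ord.
Qed.

(** * The annihilator series *)

Hypothesis nondeg : nondegenerate b.

Lemma nondegenerate_eq0 u : (forall v, b u v = 0) -> u = 0.
Proof.
move=> bu0; apply/eqP; rewrite -memv0 -(eqP nondeg).
by apply/mem_orthovP=> v _.
Qed.

Lemma mem_Ebg_ann1 x : (x \in ann_iter mul 1) = (x.1.1 == 0) && (x.1.2 == 0).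
Proof.
apply/mem_ann_iterP/andP; last first.
  case: x => [[u a] c] /= [/eqP-> /eqP->] [[v a'] c'] /=; rewrite !memv0.
  by rewrite linear0 !linear0l !linear0r mul0r mulr0 addr0.
move=> h; split; apply/eqP.
  (* Multiplying by [(v, 0, 0)] puts [b u v] in the middle coordinate, which kills [u]; then
     multiplying by [Ebg_e1] puts [a] in the last one. *)
  apply: nondegenerate_eq0 => v; have [+ _] := h (Ebg_inU v).
  by case: x {h} => [[u a] c]; rewrite memv0 => /eqP[].
have [+ _] := h Ebg_e1; case: x {h} => [[u a] c]; rewrite memv0 => /eqP[_].
by rewrite linear0r mulr1 add0r => ->.
Qed.

Lemma mem_Ebg_ann2 x : (x \in ann_iter mul 2) = (x.1.1 == 0).
Proof.
apply/mem_ann_iterP/eqP.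
  move=> h; apply: nondegenerate_eq0 => v; have [+ _] := h (Ebg_inU v).
  by case: x {h} => [[u a] c]; rewrite mem_Ebg_ann1 => /andP[_ /eqP].
case: x => [[u a] c] /= -> [[v a'] c'].
by rewrite !mem_Ebg_ann1 /= linear0l linear0r !eqxx.
Qed.

(** Every product has zero [U]-component, hence lies in ann^2. *)
Lemma Ebg_ann3 : ann_iter mul 3 = fullv.
Proof.
apply/vspaceP=> x; rewrite memvf; apply/mem_ann_iterP.
by case: x => [[u a] c] [[v a'] c']; rewrite !mem_Ebg_ann2 /= !eqxx.
Qed.

Lemma Ebg_ann1E : ann_iter mul 1 = <[Ebg_e2]>%VS.
Proof.
apply/vspaceP=> x; rewrite mem_Ebg_ann1; apply/andP/vlineP.
  move=> [/eqP x1 /eqP x2]; exists x.2.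
  by rewrite [LHS]EbgE x1 x2 linear0 scale0r !add0r.
by case=> k ->; rewrite /= !scaler0.
Qed.

Lemma Ebg_ann2E : ann_iter mul 2 = <<[:: Ebg_e1; Ebg_e2]>>%VS.
Proof.
apply/vspaceP=> x; rewrite mem_Ebg_ann2 span_cons span_seq1.
apply/eqP/idP => [x1|/memv_addP[_ /vlineP[k ->] [_ /vlineP[l ->] ->]]].
  by rewrite [x]EbgE x1 linear0 add0r memv_add ?memvZ ?memv_line.
by rewrite /= !scaler0 addr0.
Qed.

Lemma Ebg_e2_neq0 : Ebg_e2 != 0.
Proof. by apply/eqP=> -[/eqP]; rewrite oner_eq0. Qed.

Lemma dim_Ebg_ann1 : \dim (ann_iter mul 1) = 1%N.
Proof. by rewrite Ebg_ann1E dim_vline Ebg_e2_neq0. Qed.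

Lemma dim_Ebg_ann2 : \dim (ann_iter mul 2) = 2%N.
Proof.
rewrite Ebg_ann2E; apply: (eqnP (_ : free [:: Ebg_e1; Ebg_e2])).
rewrite free_cons seq1_free Ebg_e2_neq0 andbT.
rewrite span_seq1; apply/vlineP => -[k [_ /eqP + _]].
by rewrite scaler0 oner_eq0.
Qed.

(** * Nilpotency and type *)

Lemma Ebg_nilpotent : nilpotent_alg mul.
Proof.
have A2 : (alg_pow mul 2 <= ann_iter mul 2)%VS.
  rewrite alg_powS // big_nat1; apply/prod_spaceP=> x y _ _.
  by rewrite mem_Ebg_ann2; case: x y => [[u a] c] [[v a'] c'] /=.
have prod2l V := proj1 (prod_space_annS mul 1 _ V A2).
have prod2r V := proj2 (prod_space_annS mul 1 _ V A2).
have A3 : (alg_pow mul 3 <= ann_iter mul 1)%VS.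
  rewrite alg_powS // big_ltn // big_ltn // big_geq // addv0 subv_add.
  by rewrite prod2l prod2r.
have prod3l V := subv_trans (proj1 (prod_space_annS mul 0 _ V A3)) (sub0v _).
have prod3r V := subv_trans (proj2 (prod_space_annS mul 0 _ V A3)) (sub0v _).
(* A^4 contains the summand A^2 A^2, which is only bounded by ann^1, as [Ebg_e1] squares to
   [Ebg_e2]. In A^5 every summand has a factor A^3 or A^4 inside ann^1, so all vanish. *)
have A4 : (alg_pow mul 4 <= ann_iter mul 1)%VS.
  rewrite alg_powS // big_ltn // big_ltn // big_ltn // big_geq // addv0.
  by rewrite !subv_add prod3l prod3r prod2l.
exists 5%N; split=> //; apply/eqP; rewrite -subv0.
have [prod41 prod14] := prod_space_annS mul 0 _ (alg_pow mul 1) A4.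
rewrite alg_powS // big_ltn // big_ltn // big_ltn // big_ltn // big_geq //.
by rewrite addv0 !subv_add prod14 prod3l prod3r prod41.
Qed.

Lemma Ebg_has_type : {:U}%VS != 0%VS -> has_type mul [:: 1; 1; \dim {:U}]%N.
Proof.
move=> U0; split=> [|r|i]; first exact: Ebg_ann3.
  (* Minimality of 3: the terms of index 0, 1, 2 have dimensions 0, 1, 2, all below [(\dim {:U}).+2]
     because [U] is nonzero. *)
  have gt2 r' : \dim (ann_iter mul r') = (\dim {:U}).+2 -> (2 < r')%N.
    have Ugt0 : (0 < \dim {:U})%N by rewrite lt0n dimv_eq0.
    case: r' => [|[|[|]]] //.
    - by rewrite dimv0.
    - by rewrite dim_Ebg_ann1.
    - by rewrite dim_Ebg_ann2 => -[e]; rewrite -e in Ugt0.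
  by move=> r_full; apply: gt2; rewrite r_full dim_Ebg.
case: i => [|[|[|]]] // _.
- by rewrite dim_Ebg_ann1 dimv0.
- by rewrite dim_Ebg_ann2 dim_Ebg_ann1.
- by rewrite Ebg_ann3 dim_Ebg_ann2 dim_Ebg subn2.
Qed.

End AlgebraOfForm.

Theorem proposition4p4 (F : fieldType) (hF : 2%N \notin [pchar F])
  (U : vectType F) (n : nat) (hU : {:U}%VS != 0%VS)
  (hn : \dim {:U} = n)
  (b : {symmetric U}) (hb : nondegenerate b)
  (g : 'End(U)) (hg : diagonalizable_end g)
  (hgb : forall u v : U, b (g u) v = b u (g v)) :
  [/\ evolution_alg (Ebg_mul b g), nilpotent_alg (Ebg_mul b g)
    & has_type (Ebg_mul b g) [:: 1; 1; n]%N].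
Proof.
split; [exact: Ebg_evolution | exact: Ebg_nilpotent |].
by rewrite -hn; apply: Ebg_has_type.
Qed.
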